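(* Let $n \in \mathbb{N}$, $m \in \{0,\ldots,n-1\}$, $m < s \le n$, and $0 < \alpha \le 1$. Then there is a constant $c = c(n,m,s,\alpha) > 0$ such that for every $A \subset \mathbb{R}^n$ with $\mathcal{P}^s(A) < \infty$ it holds that \[ \limsup_{r \downarrow 0} \inf_{\theta \in S^{n-1},\, V \in G(n,n-m)} \frac{\mathcal{P}^s\bigl( A \cap X(x,r,V,\alpha) \setminus H(x,\theta,\alpha) \bigr)}{(2r)^s} \ge c \] for $\mathcal{P}^s$-almost every $x \in A$.
   Context: $G(n,n-m)$ denotes the space of all $(n-m)$-dimensional linear subspaces of $\mathbb{R}^n$, and $S^{n-1}$ is the unit sphere of $\mathbb{R}^n$. For $x \in \mathbb{R}^n$, $\theta \in S^{n-1}$, $0<\alpha\le 1$, $r>0$ and $V \in G(n,n-m)$: $H(x,\theta,\alpha) = \{ y \in \mathbb{R}^n : (y-x)\cdot\theta > \alpha|y-x| \}$, $X(x,V,\alpha) = \{ y \in \mathbb{R}^n : \operatorname{dist}(y-x,V) < \alpha|y-x| \}$, $X(x,r,V,\alpha) = B(x,r) \cap X(x,V,\alpha)$, where $B(x,r)$ is the closed ball centered at $x$ with radius $r$. $\mathcal{P}^s$ denotes the $s$-dimensional packing measure on $\mathbb{R}^n$: first the packing premeasure $P^s_0(E) = \lim_{\delta \downarrow 0} \sup \{ \sum_i (2r_i)^s : \{B(x_i,r_i)\}_i \text{ pairwise disjoint closed balls}, x_i \in E, r_i \le \delta \}$, and then $\mathcal{P}^s(E) = \inf\{ \sum_i P^s_0(E_i)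 : E \subset \bigcup_i E_i \}$ (the standard construction as in Mattila, Geometry of Sets and Measures in Euclidean Spaces). The constant $c$ depends only on $n,m,s,\alpha$. *)

(* Defs.v *)
From HB Require Import structures.
From mathcomp Require Import all_boot all_order all_algebra.
From mathcomp Require Import all_classical all_reals all_analysis.
Set Implicit Arguments. Unset Strict Implicit. Unset Printing Implicit Defensive.
Import Order.TTheory GRing.Theory Num.Theory.
Import numFieldNormedType.Exports.
Local Open Scope classical_set_scope.
Local Open Scope ring_scope.

Section Defs.
Variables (R : realType) (n : nat).
Notation pt := 'rV[R]_n.

Definition edot (x y : pt) : R := \sum_(i < n) x ord0 i * y ord0 i.
Definition enorm (x : pt) : R := Num.sqrt (edot x x).

Definition cball (x : pt) (r : R) : set pt := [set y | enorm (y - x) <= r].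

Definition sphere : set pt := [set t | enorm t = 1].

(* G(n,k): a k-dimensional linear subspace of R^n, represented by a square
   matrix whose row space is the subspace, of rank k. *)
Definition grass (k : nat) : set 'M[R]_n := [set V | \rank V = k].

Definition dist_sub (w : pt) (V : 'M[R]_n) : R :=
  inf [set enorm (w - v) | v in [set v : pt | (v <= V)%MS]].

Definition Hcone (x theta : pt) (alpha : R) : set pt :=
  [set y | edot (y - x) theta > alpha * enorm (y - x)].

Definition Xcone (x : pt) (V : 'M[R]_n) (alpha : R) : set pt :=
  [set y | dist_sub (y - x) V < alpha * enorm (y - x)].

Definition Xcone_r (x : pt) (r : R) (V : 'M[R]_n) (alpha : R) : set pt :=
  cball x r `&` Xcone x V alpha.

Definition packing (E : set pt) (delta : R) (F : seq (pt * R)) : Prop :=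
  (forall b, b \in F -> E b.1 /\ 0 < b.2 <= delta) /\
  (forall i j, (i < size F)%N -> (j < size F)%N -> i <> j ->
     cball (nth (0, 0) F i).1 (nth (0, 0) F i).2 `&`
     cball (nth (0, 0) F j).1 (nth (0, 0) F j).2 = set0).

(* sup of sum_i (2 r_i)^s over delta-packings; countable packings give the
   same supremum as finite ones since the terms are nonnegative. *)
Definition packing_sup (s : R) (E : set pt) (delta : R) : \bar R :=
  ereal_sup [set ((\sum_(b <- F) (2 * b.2) `^ s)%:E)%E | F in packing E delta].

(* packing premeasure P^s_0: the limit as delta decreases to 0 of the
   (nonincreasing in delta) quantity above, i.e. its infimum over delta > 0. *)
Definition packing_pre (s : R) (E : set pt) : \bar R :=
  ereal_inf [set packing_sup s E delta | delta in [set d : R | 0 < d]].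

Definition packing_measure (s : R) (E : set pt) : \bar R :=
  ereal_inf [set (\sum_(0 <= i <oo) packing_pre s (Es i))%E
            | Es in [set Es : nat -> set pt | E `<=` \bigcup_i Es i]].

Definition limsup0 (f : R -> \bar R) : \bar R :=
  ereal_inf [set ereal_sup [set f r | r in [set r : R | 0 < r < d]]
            | d in [set d : R | 0 < d]].

End Defs.

(* Main.v *)
(* Three points x, y, z that lie in a thin strip along V and are such that the
   angle at x is almost pi give, for every theta, a ball around y or z inside
   X(x,r,V,alpha) \ H(x,theta,alpha).  Assume the density condition fails with a
   small constant at all points of E and all small scales, while balls of
   radius r centred on E carry mass at least c1 (2r)^s; the latter may be assumed
   since the lower density of the packing measure is bounded below at almost
   every point of A, by a Vitali covering argument.  Then no such triple with
   mutual distances > t r exists in a ball of radius r.  There are about t^-m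
   strips, and finitely many cells of planes V and of directions, so by the
   pigeonhole principle a t r-separated subset of E in such a ball has at most
   C t^-m points.  Since C t^-m < t^-s' for some s' < s and small t, this bounds
   the packing sums of exponent s' at all scales, and E is P^s-null. *)

Require Import Defs.
From HB Require Import structures.
From mathcomp Require Import all_boot all_order all_algebra.
From mathcomp Require Import all_classical all_reals all_analysis.
From mathcomp Require Import ring lra zify.
Import Order.TTheory GRing.Theory Num.Theory.
Local Open Scope classical_set_scope.
Local Open Scope ring_scope.

(** * The packing measure as an outer measure *)

Section PackingMeasure.
Context {R : realType} {n : nat}.
Implicit Types (E : set 'rV[R]_n) (s d : R).

Lemma packing_pre_ge0 s E : (0 <= packing_pre s E)%E.
Proof.
apply: le_ereal_inf_tmp => _ [d _ <-]; apply: ereal_sup_ubound.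
by exists [::]; [split|rewrite big_nil].
Qed.

Lemma packing_pre0 s : packing_pre s (set0 : set 'rV[R]_n) = 0%E.
Proof.
apply/eqP; rewrite eq_le packing_pre_ge0 andbT.
apply: (@le_trans _ _ (packing_sup s (set0 : set 'rV[R]_n) 1)).
  by apply: ereal_inf_lbound; exists 1 => //=.
apply: ge_ereal_sup => _ [[|b F] [FE _] <-]; first by rewrite big_nil.
by have [] := FE b (mem_head _ _).
Qed.

Lemma packing_sub E E' d F : E `<=` E' -> packing E d F -> packing E' d F.
Proof. by move=> EE' [FE Fd]; split => // b /FE[/EE']. Qed.

Lemma le_packing_pre s E E' :
  E `<=` E' -> (packing_pre s E <= packing_pre s E')%E.
Proof.
move=> EE'; apply: le_ereal_inf_tmp => _ [d d0 <-].
apply: (@le_trans _ _ (packing_sup s E d)); first by apply: ereal_inf_lbound; exists d.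
apply: ereal_sup_le => _ [F /(packing_sub _ _ _ _ EE') FE' <-].
by exists F.
Qed.

Definition discr : Type := 'rV[R]_n.
HB.instance Definition _ := Choice.on discr.
HB.instance Definition _ := isPointed.Build discr (0 : 'rV[R]_n).
HB.instance Definition _ := @isMeasurable.Build default_measure_display
  discr discrete_measurable discrete_measurable0
  discrete_measurableC discrete_measurableU.

(* For the discrete sigma-algebra the outer measure induced by a premeasure
   ranges over arbitrary countable covers. *)
Lemma packing_measureE s :
  packing_measure s = mu_ext (packing_pre s : set discr -> \bar R).
Proof.
apply/funext => E; rewrite /packing_measure /mu_ext; congr ereal_inf.
by apply/seteqP; split => _ [F FE <-]; exists F => //; last by case: FE.
Qed.

Lemma packing_measure_ge0 s E : (0 <= packing_measure s E)%E.
Proof. by rewrite packing_measureE; apply: mu_ext_ge0; exact: packing_pre_ge0. Qed.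

Lemma packing_measure0 s : packing_measure s (set0 : set 'rV[R]_n) = 0%E.
Proof.
by rewrite packing_measureE; apply: mu_ext0; [exact: packing_pre0|exact: packing_pre_ge0].
Qed.

Lemma le_packing_measure s E E' :
  E `<=` E' -> (packing_measure s E <= packing_measure s E')%E.
Proof. by move=> EE'; rewrite packing_measureE; exact: (@le_mu_ext _ discr). Qed.

Lemma packing_measure_sigma_subadditive s (E : nat -> set 'rV[R]_n) :
  (packing_measure s (\bigcup_i E i) <= \sum_(i <oo) packing_measure s (E i))%E.
Proof.
rewrite packing_measureE.
exact: (@mu_ext_sigma_subadditive _ discr R _ (packing_pre_ge0 s) E).
Qed.

Lemma packing_measureU s E E' :
  (packing_measure s (E `|` E') <= packing_measure s E + packing_measure s E')%E.
Proof.
rewrite -bigcup2E; apply: le_trans (packing_measure_sigma_subadditive _ _) _.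
rewrite (nneseries_split 0 2); last by move=> *; exact: packing_measure_ge0.
rewrite add0n big_nat_recr//= big_nat1 eseries0 ?adde0// => -[|[|k]]// _ _.
by rewrite packing_measure0.
Qed.

Lemma packing_measure_bigcup0 s (E : nat -> set 'rV[R]_n) :
  (forall i, packing_measure s (E i) = 0%E) ->
  packing_measure s (\bigcup_i E i) = 0%E.
Proof.
move=> E0; apply/eqP; rewrite eq_le packing_measure_ge0 andbT.
by apply: le_trans (packing_measure_sigma_subadditive _ _) _; rewrite eseries0.
Qed.

Lemma packing_measure_le_pre s E : (packing_measure s E <= packing_pre s E)%E.
Proof.
apply: ereal_inf_lbound; exists (bigcup2 E set0).
  by move=> x Ex; exists 0%N.
rewrite (nneseries_split 0 1); last by move=> *; exact: packing_pre_ge0.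
rewrite add0n big_nat1 eseries0 ?adde0// => -[|[|k]]// _ _;
by rewrite packing_pre0.
Qed.

Lemma packing_measure_big_le s (T : eqType) (G : seq T) (E : T -> set 'rV[R]_n)
    (f : T -> R) :
  (forall b, b \in G -> (packing_measure s (E b) <= (f b)%:E)%E) ->
  (packing_measure s [set x | exists2 b, b \in G & E b x]
    <= (\sum_(b <- G) f b)%:E)%E.
Proof.
elim: G => [|b G IH] Gf.
  rewrite big_nil [X in packing_measure s X](_ : _ = set0) ?packing_measure0//.
  by apply/seteqP; split=> x // -[].
apply: (@le_trans _ _ (packing_measure s
    (E b `|` [set x | exists2 b, b \in G & E b x]))).
  apply: le_packing_measure => x [c]; rewrite inE => /orP[/eqP ->|cG] Ec.
    by left.
  by right; exists c.
apply: le_trans (packing_measureU _ _ _) _.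
rewrite big_cons EFinD leeD ?Gf ?mem_head//.
by apply: IH => c cG; rewrite Gf// inE cG orbT.
Qed.

End PackingMeasure.

(** * Euclidean geometry *)

Section Euclid.
Context {R : realType} {n : nat}.
Implicit Types (x y z u : 'rV[R]_n) (a e : R).

Lemma edotC x y : edot x y = edot y x.
Proof. by apply: eq_bigr => i _; rewrite mulrC. Qed.

Lemma edotDl x y z : edot (x + y) z = edot x z + edot y z.
Proof. by rewrite -big_split; apply: eq_bigr => i _; rewrite mxE mulrDl. Qed.

Lemma edotZl a x z : edot (a *: x) z = a * edot x z.
Proof. by rewrite mulr_sumr; apply: eq_bigr => i _; rewrite mxE mulrA. Qed.

Lemma edotNl x z : edot (- x) z = - edot x z.
Proof. by rewrite -scaleN1r edotZl mulN1r. Qed.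

Lemma edotDr z x y : edot z (x + y) = edot z x + edot z y.
Proof. by rewrite edotC edotDl !(edotC z). Qed.

Lemma edotZr a z x : edot z (a *: x) = a * edot z x.
Proof. by rewrite edotC edotZl (edotC z). Qed.

Lemma edotNr z x : edot z (- x) = - edot z x.
Proof. by rewrite edotC edotNl (edotC z). Qed.

Lemma edot0l z : edot 0 z = 0.
Proof. by rewrite -(scale0r (0 : 'rV[R]_n)) edotZl mul0r. Qed.

Lemma edot_ge0 x : 0 <= edot x x.
Proof. by apply: sumr_ge0 => i _; rewrite -expr2 sqr_ge0. Qed.

Lemma edot_eq0 x : (edot x x == 0) = (x == 0).
Proof.
apply/idP/eqP => [|->]; last by rewrite edot0l.
rewrite psumr_eq0 => [/allP x0|i _]; last by rewrite -expr2 sqr_ge0.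
apply/rowP => i; rewrite mxE; apply/eqP.
by have := x0 i (mem_index_enum _); rewrite -expr2 sqrf_eq0.
Qed.

Lemma enorm_ge0 x : 0 <= enorm x. Proof. exact: sqrtr_ge0. Qed.

Lemma enorm_sqr x : enorm x ^+ 2 = edot x x.
Proof. by rewrite sqr_sqrtr// edot_ge0. Qed.

Lemma enorm_eq0 x : (enorm x == 0) = (x == 0).
Proof. by rewrite -edot_eq0 -enorm_sqr sqrf_eq0. Qed.

Lemma enorm0 : enorm (0 : 'rV[R]_n) = 0.
Proof. by apply/eqP; rewrite enorm_eq0. Qed.

Lemma enormN x : enorm (- x) = enorm x.
Proof. by rewrite /enorm edotNl edotNr opprK. Qed.

Lemma enormB x y : enorm (x - y) = enorm (y - x).
Proof. by rewrite -enormN opprB. Qed.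

Lemma enormZ a x : enorm (a *: x) = `|a| * enorm x.
Proof. by rewrite /enorm edotZl edotZr mulrA -expr2 sqrtrM ?sqr_ge0// sqrtr_sqr. Qed.

(** Cauchy-Schwarz, obtained by expanding the square norm of [edot y y *: x - edot x y *: y]. *)
Lemma edot_le x y : `|edot x y| <= enorm x * enorm y.
Proof.
rewrite -(@ler_pXn2r _ 2)// ?nnegrE ?mulr_ge0 ?enorm_ge0//.
rewrite real_normK ?num_real// exprMn !enorm_sqr.
have [->|y0] := eqVneq y 0; first by rewrite edotC !edot0l expr0n mulr0.
have yy : 0 < edot y y by rewrite lt_def edot_eq0 y0 edot_ge0.
have := edot_ge0 (edot y y *: x - edot x y *: y).
rewrite !(edotDl, edotDr, edotNl, edotNr, edotZl, edotZr) (edotC y x).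
set a := edot x y; set b := edot y y; set c := edot x x.
rewrite (_ : _ + _ = b * (c * b - a ^+ 2)); last by ring.
by rewrite pmulr_rge0// subr_ge0.
Qed.

Lemma enormD x y : enorm (x + y) <= enorm x + enorm y.
Proof.
rewrite -(@ler_pXn2r _ 2)// ?nnegrE ?addr_ge0 ?enorm_ge0//.
rewrite sqrrD !enorm_sqr !(edotDl, edotDr) (edotC y x).
have := le_trans (ler_norm _) (edot_le x y); lra.
Qed.

Lemma enorm_tri y x z : enorm (x - z) <= enorm (x - y) + enorm (y - z).
Proof. by rewrite (_ : x - z = (x - y) + (y - z)) ?enormD// addrA subrK. Qed.

Lemma entry_le_enorm x i : `|x ord0 i| <= enorm x.
Proof.
rewrite -(@ler_pXn2r _ 2)// ?nnegrE ?enorm_ge0//.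
rewrite enorm_sqr real_normK ?num_real// /edot (bigD1 i)//= -expr2 lerDl.
by apply: sumr_ge0 => j _; rewrite -expr2 sqr_ge0.
Qed.

Lemma enorm_le_entries x e :
  0 <= e -> (forall i, `|x ord0 i| <= e) -> enorm x <= n%:R * e.
Proof.
move=> e0 xe; rewrite -(@ler_pXn2r _ 2)// ?nnegrE ?enorm_ge0 ?mulr_ge0//.
apply: (@le_trans _ _ (n%:R * e ^+ 2)).
  rewrite enorm_sqr -[n in n%:R]card_ord mulr_natl -sumr_const.
  apply: ler_sum => i _.
  by rewrite -expr2 -(real_normK (num_real (x _ _))) ler_pXn2r ?nnegrE.
rewrite exprMn ler_wpM2r ?sqr_ge0// -natrX ler_nat.
by case: (n) => // k; rewrite expnS expn1 leq_pmulr.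
Qed.

End Euclid.

(** * Unit normals and the distance to a subspace *)

Section Normals.
Context {R : realType} {n : nat}.
Implicit Types (V : 'M[R]_n) (w u v : 'rV[R]_n).

Lemma dist_sub_le V w v : (v <= V)%MS -> dist_sub w V <= enorm (w - v).
Proof.
move=> vV; apply: ge_inf; last by exists v.
by exists 0 => _ [u _ <-]; exact: enorm_ge0.
Qed.

Lemma dist_sub_lip V w w' : dist_sub w V <= dist_sub w' V + enorm (w - w').
Proof.
rewrite -lerBlDr; apply: lb_le_inf; first by exists (enorm (w' - 0)), 0 => //=; rewrite sub0mx.
move=> _ [v vV <-]; rewrite lerBlDr addrC.
by apply: le_trans (dist_sub_le _ _ _ vV) _; exact: enorm_tri.
Qed.

(** A nonzero vector of the kernel of [V^T] is orthogonal to the row space of [V]; it remains to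
    normalise it. *)
Lemma unit_normal V : (\rank V < n)%N ->
  exists2 u, enorm u = 1 & forall v, (v <= V)%MS -> edot v u = 0.
Proof.
move=> rV; have /rowV0Pn [u uK u0] : kermx V^T != 0.
  by rewrite -mxrank_eq0 mxrank_ker mxrank_tr subn_eq0 -ltnNge.
have uV v : (v <= V)%MS -> edot v u = 0.
  move=> /submxP[D ->]; rewrite edotC.
  have /sub_kermxP /(congr1 (mulmx^~ D^T)) := uK.
  rewrite -mulmxA -trmx_mul mul0mx => /matrixP /(_ ord0 ord0).
  by rewrite !mxE => uD; rewrite -[RHS]uD; apply: eq_bigr => i _; rewrite !mxE.
have un : enorm u != 0 by rewrite enorm_eq0.
exists ((enorm u)^-1 *: u) => [|v /uV vu]; last by rewrite edotZr vu mulr0.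
by rewrite enormZ ger0_norm ?invr_ge0 ?enorm_ge0// mulVf.
Qed.

(* A subspace of codimension m is cut out by m unit normals; adding them one
   at a time to V, each one changes the distance by at most its component. *)
Lemma dist_sub_normals m V : (\rank V + m = n)%N ->
  exists u : 'I_m -> 'rV[R]_n, (forall i, enorm (u i) = 1) /\
    forall w, dist_sub w V <= \sum_(i < m) `|edot w (u i)|.
Proof.
elim: m V => [|m IH] V rV.
  exists (fun=> 0); split => [[]//|w]; rewrite big_ord0.
  have wV : (w <= V)%MS.
    by apply: submx_full; rewrite /row_full; rewrite addn0 in rV; apply/eqP.
  by apply: le_trans (dist_sub_le _ _ _ wV) _; rewrite subrr enorm0.
have [|u u1 uV] := unit_normal V; first lia.
have uu : edot u u = 1 by rewrite -enorm_sqr u1 expr1n.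
have rVu : (\rank (V + u)%MS + m = n)%N.
  have dVu : mxdirect (V + u).
    apply/mxdirect_addsP/eqP/rowV0P => v; rewrite sub_capmx => /andP[vV].
    move=> /sub_rVP[a va]; have := uV _ vV.
    by rewrite va edotZl uu mulr1 => ->; rewrite scale0r.
  rewrite (mxdirectP dVu)/= (_ : \rank u = 1%N) ?addn1 ?addSnnS//.
  by rewrite rank_rV -enorm_eq0 u1 oner_eq0.
have [f [f1 fV]] := IH (V + u)%MS rVu.
exists (fun i => if unlift ord0 i is Some j then f j else u); split => [i|w].
  by case: unlift.
rewrite big_ord_recl unlift_none; under eq_bigr => i _ do rewrite liftK.
rewrite -lerBlDl; apply: le_trans (fV w).
apply: lb_le_inf; first by exists (enorm (w - 0)), 0 => //=; rewrite sub0mx.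
move=> _ [v' /sub_addsmxP[[a b] /= ->] <-]; rewrite lerBlDl.
have /sub_rVP[c ->] : (b *m u <= u)%MS by rewrite submxMl.
have vV : (a *m V <= V)%MS by rewrite submxMl.
set v := a *m V in vV *.
apply: le_trans (dist_sub_le _ _ _ vV) _.
(* [p] is the part of [w - v] orthogonal to [u]; by Pythagoras it is no longer than
   [w - v - c *: u]. *)
set p := (w - v) - edot w u *: u.
rewrite (_ : w - v = edot w u *: u + p); last by rewrite /p [RHS]addrC subrK.
apply: le_trans (enormD _ _) _; rewrite enormZ u1 mulr1 lerD2l.
rewrite (_ : w - _ = p + (edot w u - c) *: u); last first.
  by rewrite /p scalerBl [RHS]addrA subrK opprD addrA.
have pu : edot p u = 0.
  by rewrite /p !edotDl !edotNl edotZl uu (uV _ vV); ring.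
clearbody p.
rewrite -(@ler_pXn2r _ 2)// ?nnegrE ?enorm_ge0//.
rewrite !enorm_sqr !(edotDl, edotDr, edotZl, edotZr) uu (edotC u p) pu.
by rewrite !mulr0 addr0 add0r mulr1 lerDl -expr2 sqr_ge0.
Qed.

End Normals.

(** * Lower density of the packing measure *)

Section Packings.
Context {R : realType} {n : nat}.
Implicit Types (E : set 'rV[R]_n) (s d : R) (a b : 'rV[R]_n * R).

Definition disjb a b : bool := `[< cball a.1 a.2 `&` cball b.1 b.2 = set0 >].

Lemma disjbC a b : disjb a b = disjb b a.
Proof. by rewrite /disjb setIC. Qed.

Lemma packingP E d F : packing E d F <->
  (forall b, b \in F -> E b.1 /\ 0 < b.2 <= d) /\ pairwise disjb F.
Proof.
split=> -[FE Fd]; split=> //.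
  apply/(pairwiseP (0, 0)) => i j iF jF ij.
  by rewrite /disjb; apply/asboolP; apply: Fd => // ij'; rewrite ij' ltnn in ij.
move=> i j iF jF ij; move/(pairwiseP (0, 0)): Fd => Fd.
have [{}ij|{}ij|//] := ltngtP i j; first exact/asboolP/(Fd i j).
by rewrite setIC; exact/asboolP/(Fd j i).
Qed.

Lemma disjb_far a b : 0 <= a.2 -> 0 <= b.2 -> disjb a b ->
  a.2 < enorm (a.1 - b.1) /\ b.2 < enorm (a.1 - b.1).
Proof.
move=> a0 b0 /asboolP ab; split; rewrite ltNge; apply/negP => h.
  suff : (set0 : set 'rV[R]_n) b.1 by [].
  by rewrite -ab; split; rewrite /cball/= ?subrr ?enorm0// enormB.
suff : (set0 : set 'rV[R]_n) a.1 by [].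
by rewrite -ab; split; rewrite /cball/= ?subrr ?enorm0.
Qed.

Lemma disjbN_near a b : ~~ disjb a b -> enorm (a.1 - b.1) <= a.2 + b.2.
Proof.
move=> /asboolP/eqP/set0P[z [za zb]]; rewrite /cball/= in za zb.
by apply: le_trans (enorm_tri z _ _) _; rewrite (enormB a.1) lerD.
Qed.

Lemma packing_sup_ge s E d F : packing E d F ->
  ((\sum_(b <- F) (2 * b.2) `^ s)%:E <= packing_sup s E d)%E.
Proof. by move=> EF; apply: ereal_sup_ubound; exists F. Qed.

Lemma packing_sup_ge0 s E d : (0 <= packing_sup s E d)%E.
Proof. by apply: ereal_sup_ubound; exists [::]; [split|rewrite big_nil]. Qed.

(** Each ball adds at least (2e)^s to a packing sum, and these sums are bounded. *)
Lemma packing_size_bounded s E d e : 0 <= s -> 0 < e ->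
  (packing_sup s E d < +oo)%E ->
  exists N, forall F, packing E d F -> (forall b, b \in F -> e <= b.2) ->
    (size F <= N)%N.
Proof.
move=> s0 e0 Efin; set w := (2 * e) `^ s.
have w0 : 0 < w by rewrite powR_gt0; lra.
set S := fine (packing_sup s E d).
exists (Num.truncn (S / w)).+1 => F EF eF.
have SE : packing_sup s E d = S%:E.
  by rewrite fineK// ge0_fin_numE// packing_sup_ge0.
have := packing_sup_ge s _ _ _ EF; rewrite SE lee_fin => FS.
suff : (size F)%:R <= S / w.
  move=> h; rewrite -ltnS -(ltr_nat R) (le_lt_trans h)//.
  apply: lt_le_trans (truncnS_gt _) _; by rewrite ler_nat.
rewrite ler_pdivlMr// (le_trans _ FS)//.
rewrite (_ : _ * w = \sum_(b <- F) w); last first.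
  by rewrite big_const_seq count_predT iter_addr_0 mulr_natl.
rewrite !big_seq; apply: ler_sum => b bF; rewrite ge0_ler_powR ?nnegrE//; have := eF _ bF; lra.
Qed.

(** Otherwise every list satisfying [P] could be lengthened, past the bound [N]. *)
Lemma seq_maximal (T : Type) (P : seq T -> Prop) (N : nat) :
  P [::] -> (forall G, P G -> (size G <= N)%N) ->
  exists2 G, P G & forall x, ~ P (x :: G).
Proof.
move=> P0 PN; apply: contrapT => H.
have ext G : P G -> exists x, P (x :: G).
  by move=> PG; apply: contrapT => /forallNP PxG; apply: H; exists G.
have long k : exists2 G, P G & size G = k.
  elim: k => [|k [G /ext[x Px] Gk]]; first by exists [::].
  by exists (x :: G) => //=; rewrite Gk.
by have [G /PN GN GE] := long N.+1; rewrite GE ltnn in GN.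
Qed.

(* Vitali selection by dyadic generations of radii: the finite premeasure
   bounds the number of disjoint balls of each generation, so each one can be
   chosen as a finite list of maximal length. *)
Lemma vitali_selection s E d (r : 'rV[R]_n -> R) : 0 <= s -> 0 < d ->
  (packing_sup s E d < +oo)%E -> (forall x, E x -> 0 < r x <= d) ->
  exists G : nat -> seq 'rV[R]_n,
    (forall k, packing E d [seq (x, r x) | x <- \big[cat/[::]]_(0 <= i < k) G i]) /\
    forall x, E x -> exists k, exists2 b, b \in G k & enorm (x - b) <= 3 * r b.
Proof.
move=> s0 d0 Efin rd; pose rho k := d / 2 ^+ k.
have rho0 k : 0 < rho k by rewrite divr_gt0// exprn_gt0.
have rhoS k : rho k = 2 * rho k.+1.
  by rewrite /rho exprSr invfM; field; rewrite expf_neq0.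
pose rball F := [seq (x, r x) | x <- F] : seq ('rV[R]_n * R).
pose valid k (F : seq 'rV[R]_n) := packing E d (rball F) /\ forall x, x \in F -> rho k < r x.
pose cov (F : seq 'rV[R]_n) x := exists2 b, b \in F & enorm (x - b) <= 3 * r b.
(* Invariant after [k] generations: disjoint balls of radius above [rho k], whose threefold
   enlargements catch every point of [E] with such a radius. *)
pose Inv k F := valid k F /\ forall x, E x -> rho k < r x -> cov F x.
have step k F : exists G, Inv k F -> Inv k.+1 (F ++ G).
  have [FI|] := pselect (Inv k F); last by exists [::].
  have [[FE Fr] Fcov] := FI.
  have [N FN] := packing_size_bounded _ _ _ _ s0 (rho0 k.+1) Efin.
  have [|G /= GF|G GF Gmax] := @seq_maximal _ (fun G => valid k.+1 (G ++ F)) N.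
  - by split=> // x xF; have := Fr _ xF; rewrite (rhoS k); have := rho0 k.+1; lra.
  - have [GE Gr] := GF; apply: (@leq_trans (size (rball (G ++ F)))).
      by rewrite size_map size_cat leq_addr.
    by apply: FN => // _ /mapP[x xG ->]; exact/ltW/Gr.
  (* [seq_maximal] grows lists at the head, whereas generations are appended at the tail. *)
  exists G => _; have GFE : G ++ F =i F ++ G by move=> x; rewrite !mem_cat orbC.
  split; first split.
  - have [/packingP[GE Gd] _] := GF; apply/packingP; split.
      move=> _ /mapP[x xF ->]; apply: (GE (x, r x)).
      by apply: map_f; rewrite GFE.
    move: Gd; rewrite /rball !map_cat !pairwise_cat => /and3P[h -> ->].
    by rewrite !andbT allrelC (eq_allrel (r' := disjb))// => ? ?; rewrite disjbC.
  - by move=> x; rewrite -GFE => /(GF.2 _).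
  move=> x Ex rx; have [rx'|rx'] := ltP (rho k) (r x).
    by have [b bF h] := Fcov _ Ex rx'; exists b => //; rewrite mem_cat bF.
  apply: contrapT => xcov; apply: (Gmax x); split; last first.
    by move=> y; rewrite inE => /orP[/eqP->//|/GF.2].
  have [/packingP[GE Gd] Gr] := GF; apply/packingP; split.
    by move=> b; rewrite inE => /orP[/eqP->|/GE//]; split=> //=; exact: rd.
  rewrite /= Gd andbT; apply/allP => _ /mapP[b bG ->].
  (* If the ball of [x] meets the chosen ball centred at [b], then
     [r x <= rho k = 2 * rho k.+1 < 2 * r b], so [x] is within [3 * r b] of [b]. *)
  apply: contrapT => /negP/disjbN_near /= h; apply: xcov; exists b; first by rewrite -GFE.
  have := Gr _ bG; rewrite rhoS in rx'; lra.
have [nxt nxtP] := choice (fun p : nat * seq 'rV[R]_n => step p.1 p.2).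
pose F := fix F k := if k is k'.+1 then F k' ++ nxt (k', F k') else [::].
have FI k : Inv k (F k).
  elim: k => [|k IH]; last exact: (nxtP (k, F k)).
  split; first by split=> //; apply/packingP.
  (* No radius exceeds [rho 0 = d], so nothing has to be covered at the start. *)
  by move=> x /rd; rewrite /rho expr0 divr1; lra.
have FE k : F k = \big[cat/[::]]_(0 <= i < k) nxt (i, F i).
  by elim: k => [|k IH]; rewrite ?big_nil// big_nat_recr//= -IH.
exists (fun k => nxt (k, F k)); split=> [k|x Ex]; first by rewrite -FE; case: (FI k) => -[].
have [k rk] : exists k, rho k < r x.
  have [rx _] := andP (rd _ Ex).
  exists (Num.truncn (d / r x)).+1; rewrite /rho ltr_pdivrMr ?exprn_gt0//.
  rewrite mulrC -ltr_pdivrMr//; apply: lt_le_trans (truncnS_gt _) _.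
  by rewrite -natrX ler_nat ltnW// ltn_expl.
have [b + bx] := (FI k).2 _ Ex rk.
have Fsub j : b \in F j -> exists i, b \in nxt (i, F i).
  by elim: j => [//|j IH]; rewrite mem_cat => /orP[/IH//|]; exists j.
by move=> /Fsub[i bi]; exists i, b.
Qed.

End Packings.

(** * Points of small lower density *)

Section LowerDensity.
Context {R : realType} {n : nat}.
Implicit Types (A E : set 'rV[R]_n) (s d : R).

(** The factor 3^(-s) pays for the enlargement in the Vitali covering; the factor 1/2 makes the
    covering estimate strictly better than the packing sum. *)
Definition thin A s : set 'rV[R]_n := [set x | A x /\ forall d, 0 < d ->
  exists2 r, 0 < r < d &
    (packing_measure s (A `&` cball x r) <= (2^-1 * 3 `^ (- s) * (2 * r) `^ s)%:E)%E].

(** The enlarged Vitali balls cover [E], and each meets [A] in mass at most half the packing term of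
    its ball. Summing, [E] has at most half the measure of a packing sum. *)
Lemma thin_half_sup A s E d : 0 <= s -> E `<=` thin A s -> 0 < d ->
  (packing_measure s E + packing_measure s E <= packing_sup s E d)%E.
Proof.
move=> s0 ED d0; have [Efin|] := ltP (packing_sup s E d) +oo%E; last first.
  by rewrite leye_eq => /eqP ->; rewrite leey.
have /choice[r rE] : forall x, exists r, E x -> 0 < r <= d /\
    (packing_measure s (A `&` cball x (3 * r)) <= (2^-1 * (2 * r) `^ s)%:E)%E.
  move=> x; have [/ED[Ax xD]|] := pselect (E x); last by exists 0.
  (* A third of a thin radius is used: the enlarged ball is then the thin one, and 3^(-s) (2r)^s is
     the packing term of [r / 3]. *)
  have [|r rd rA] := xD d => //; exists (r / 3) => _; split; first lra.
  rewrite mulrC divfK//; apply: le_trans rA _; rewrite lee_fin.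
  rewrite -mulrA ler_wpM2l// (_ : 2 * (r / 3) = (2 * r) * 3^-1); last by ring.
  rewrite [leRHS]powRM; [|lra|lra].
  by rewrite -[3^-1]powR_inv1// -powRrM mulN1r mulrC.
have [|G [Gpack Gcov]] := vitali_selection s E d r s0 d0 Efin; first by move=> x /rE[].
set S := fine (packing_sup s E d).
have SE : packing_sup s E d = S%:E.
  by rewrite fineK// ge0_fin_numE// packing_sup_ge0.
suff h : (packing_measure s E <= (S / 2)%:E)%E.
  by apply: le_trans (leeD h h) _; rewrite SE -EFinD lee_fin; lra.
pose U k := [set x | exists2 b, b \in G k & (A `&` cball b (3 * r b)) x].
have GE k b : b \in G k -> E b.
  move=> bG; have [/(_ (b, r b))+ _] := (packingP _ _ _).1 (Gpack k.+1).
  by case=> //; apply: map_f; rewrite big_nat_recr//= mem_cat bG orbT.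
apply: (@le_trans _ _ (packing_measure s (\bigcup_k U k))).
  apply: le_packing_measure => x Ex; have [k [b bG bx]] := Gcov x Ex.
  by exists k => //; exists b => //; split=> //; have [] := ED x Ex.
apply: le_trans (packing_measure_sigma_subadditive _ _) _.
apply: (@le_trans _ _ (\sum_(k <oo) (\sum_(b <- G k) 2^-1 * (2 * r b) `^ s)%:E)%E).
  apply: lee_nneseries => [k _ _|k _]; first exact: packing_measure_ge0.
  by apply: packing_measure_big_le => b /GE/rE[].
apply: lime_le.
  apply: is_cvg_nneseries => k _ _; rewrite lee_fin; apply: sumr_ge0 => b _.
  by rewrite mulr_ge0// powR_ge0.
apply: nearW => k; rewrite sumEFin lee_fin.
have := packing_sup_ge s _ _ _ (Gpack k); rewrite SE lee_fin big_map/=.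
rewrite (big_morph (fun F => \sum_(b <- F) (2 * r b) `^ s)
  (id1 := 0) (op1 := +%R)); last 2 first.
  by move=> ? ?; rewrite big_cat.
  by rewrite big_nil.
move=> GS; under eq_bigr do rewrite -mulr_sumr.
rewrite -mulr_sumr; lra.
Qed.

(** Applying [thin_half_sup] to the pieces of any countable cover of [D = thin A s] and taking
    infima gives 2p <= p for the measure p of [D], which is finite. *)
Lemma packing_measure_thin A s : 0 <= s -> (packing_measure s A < +oo)%E ->
  packing_measure s (thin A s) = 0%E.
Proof.
move=> s0 Afin; set D := thin A s; set p := packing_measure s D.
have p0 : (0 <= p)%E by exact: packing_measure_ge0.
have pfin : p \is a fin_num.
  rewrite ge0_fin_numE// (le_lt_trans _ Afin)//.
  by apply: le_packing_measure => x [].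
have : (p + p <= packing_measure s D)%E.
  apply: le_ereal_inf_tmp => _ [F DF <-].
  apply: (@le_trans _ _ (\sum_(i <oo) (packing_measure s (D `&` F i) +
      packing_measure s (D `&` F i)))%E).
    have h : (p <= \sum_(i <oo) packing_measure s (D `&` F i))%E.
      apply: le_trans (packing_measure_sigma_subadditive _ _).
      by apply: le_packing_measure => x Dx; have [i _ Fx] := DF x Dx; exists i.
    rewrite nneseriesD//; last 2 first.
      by move=> *; exact: packing_measure_ge0.
      by move=> *; exact: packing_measure_ge0.
    exact: leeD.
  apply: lee_nneseries => [k _ _|k _]; first by rewrite adde_ge0 ?packing_measure_ge0.
  apply: (@le_trans _ _ (packing_pre s (D `&` F k))).
    apply: le_ereal_inf_tmp => _ [d d0 <-]; apply: (thin_half_sup A) => // x [] //.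
  by apply: le_packing_pre => x [].
rewrite -/p -(fineK pfin) -EFinD lee_fin => h.
have := fine_ge0 p0 => h'; congr EFin; lra.
Qed.

End LowerDensity.

(** * Sets with few separated points are null *)

Section Counting.
Context {R : realType} {n : nat}.
Implicit Types (E : set 'rV[R]_n) (s d e t r : R) (x y : 'rV[R]_n).

Definition far e x y : bool := e < enorm (x - y).

(** Greedy choice of a maximal separated sublist; its points will serve as centres for grouping
    small balls. *)
Lemma maximal_far e (X : seq 'rV[R]_n) : 0 <= e -> exists Y,
  [/\ {subset Y <= X}, pairwise (far e) Y &
      forall x, x \in X -> exists2 y, y \in Y & enorm (x - y) <= e].
Proof.
move=> e0; elim: X => [|x X [Y [YX Yfar Ycov]]]; first by exists [::].
have [/hasP[y yY xy]|/hasPn xY] := boolP (has (fun y => enorm (x - y) <= e) Y).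
  exists Y; split=> // [z /YX zX|z]; first by rewrite inE zX orbT.
  by rewrite inE => /orP[/eqP->|/Ycov//]; exists y.
exists (x :: Y); split=> [z||z].
- by rewrite !inE => /orP[->//|/YX->]; rewrite orbT.
- by rewrite /= Yfar andbT; apply/allP => y /xY; rewrite -ltNge.
rewrite inE => /orP[/eqP->|/Ycov[y yY zy]].
  by exists x; rewrite ?mem_head// subrr enorm0.
by exists y; rewrite // inE yY orbT.
Qed.

Lemma sum_le_cover (T S : eqType) (L : seq T) (Y : seq S) (P : S -> pred T)
    (f : T -> R) : (forall b, 0 <= f b) ->
  (forall b, b \in L -> exists2 y, y \in Y & P y b) ->
  \sum_(b <- L) f b <= \sum_(y <- Y) \sum_(b <- L | P y b) f b.
Proof.
move=> f0 LY; rewrite (exchange_big_dep predT)//= !big_seq.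
apply: ler_sum => b /LY[y yY Pyb].
by rewrite (big_rem y)//= Pyb lerDl sumr_ge0.
Qed.

(** A counting condition of Assouad-dimension type: iterated over the scales t^k r, it controls
    packing sums of exponent s' as soon as N t^s' <= 1/2. *)
Definition few_far E r0 t N := forall x0 r (Y : seq 'rV[R]_n), 0 < r <= r0 ->
  (forall y, y \in Y -> E y /\ enorm (y - x0) <= r) ->
  pairwise (far (t * r)) Y -> (size Y <= N)%N.

(** Induction on the number [K] of scales. Disjoint balls of radius above [t * r] have separated
    centres, so there are at most [N] of them and they contribute at most N r^s. The others are
    grouped around at most [N] points, and by induction contribute at most N * 2N (t r)^s <= N
    r^s. *)
Lemma packing_sum_few_far E r0 t N s : 0 < t -> t <= 1 -> 0 <= s ->
  few_far E r0 t N -> N%:R * t `^ s <= 2^-1 ->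
  forall K x0 r (F : seq ('rV[R]_n * R)), 0 < r <= r0 ->
  (forall b, b \in F -> [/\ E b.1, enorm (b.1 - x0) <= r & t ^+ K * r < b.2 <= r]) ->
  pairwise disjb F ->
  \sum_(b <- F) b.2 `^ s <= 2 * N%:R * r `^ s.
Proof.
move=> t0 t1 s0 EN Nt; elim=> [|K IH] x0 r F rr0 FE Fd.
  (* For [K = 0] the range of radii is empty, hence so is the list. *)
  case: F FE {Fd} => [|b F FE]; first by rewrite big_nil !mulr_ge0 ?powR_ge0.
  by have [_ _] := FE b (mem_head _ _); rewrite expr0 mul1r => /andP[/lt_le_trans h /h]; rewrite ltxx.
have [r_gt0 _] := andP rr0.
rewrite (bigID (fun b => t * r < b.2))/=.
rewrite (_ : 2 * _ * _ = N%:R * r `^ s + N%:R * r `^ s); last by ring.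
apply: lerD.
  rewrite -big_filter; set L := [seq b <- F | t * r < b.2].
  have LF b : b \in L -> b \in F /\ t * r < b.2 by rewrite mem_filter => /andP[].
  have LN : (size L <= N)%N.
    rewrite -(size_map fst); apply: (EN x0 r) => //.
      by move=> _ /mapP[b /LF[/FE[? ? _] _] ->].
    rewrite pairwise_map.
    have : pairwise disjb L by apply: subseq_pairwise Fd; exact: filter_subseq.
    apply: (sub_in_pairwise (P := mem L)); last exact: allss.
    move=> a b /= /LF[_ ta] /LF[_ tb] /disjb_far[]; try nra.
    by move=> h _; apply: lt_trans h.
  apply: (@le_trans _ _ (\sum_(b <- L) r `^ s)).
    rewrite !big_seq; apply: ler_sum => b /LF[/FE[_ _ /andP[_ br]] tb].
    by apply: ge0_ler_powR; rewrite ?nnegrE//; nra.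
  rewrite big_const_seq count_predT iter_addr_0 -[leLHS]mulr_natl.
  by rewrite ler_wpM2r ?powR_ge0// ler_nat.
rewrite -big_filter; set L := [seq b <- F | ~~ (t * r < b.2)].
have LF b : b \in L -> b \in F /\ b.2 <= t * r.
  by rewrite mem_filter -leNgt => /andP[].
have Ld : pairwise disjb L by apply: subseq_pairwise Fd; exact: filter_subseq.
have tr0 : 0 <= t * r by rewrite ltW// mulr_gt0.
have [Y [YL Yfar Ycov]] := maximal_far _ [seq b.1 | b <- L] tr0.
have YN : (size Y <= N)%N.
  by apply: (EN x0 r) => // _ /YL/mapP[b /LF[/FE[? ? _] _] ->].
apply: (@le_trans _ _ (\sum_(y <- Y) \sum_(b <- L | enorm (b.1 - y) <= t * r) b.2 `^ s)).
  apply: sum_le_cover => b; first exact: powR_ge0.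
  by move=> bL; apply: Ycov; apply: map_f.
apply: (@le_trans _ _ (\sum_(y <- Y) 2 * N%:R * (t * r) `^ s)).
  apply: ler_sum => y _; rewrite -big_filter; apply: (IH y).
  - by rewrite mulr_gt0//=; have := andP rr0; case=> _; apply: le_trans; nra.
  - move=> b; rewrite mem_filter => /andP[by' /LF[/FE[Eb _ /andP[h _]] h']].
    by split=> //; rewrite h' andbT mulrA -exprSr.
  - by apply: subseq_pairwise Ld; exact: filter_subseq.
rewrite big_const_seq count_predT iter_addr_0 -[leLHS]mulr_natl powRM ?(ltW t0) ?(ltW r_gt0)//.
apply: (@le_trans _ _ (N%:R * (2 * N%:R * (t `^ s * r `^ s)))).
  by rewrite ler_wpM2r ?ler_nat// !mulr_ge0// powR_ge0.
rewrite (_ : _ * _ = (N%:R * r `^ s) * (2 * (N%:R * t `^ s))); last by ring.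
by rewrite ler_piMr ?mulr_ge0 ?powR_ge0//; lra.
Qed.

(** Over radii at most [d], a sum of exponent [s] is at most 2^s d^(s - s') times the bounded sum of
    exponent [s'], and this tends to 0 with [d]. *)
Lemma packing_pre_few_far E r0 t N s' s : 0 < r0 -> 0 < t -> t <= 2^-1 -> 0 <= s' < s ->
  few_far E r0 t N -> N%:R * t `^ s' <= 2^-1 ->
  forall x0, E `<=` cball x0 r0 -> packing_pre s E = 0%E.
Proof.
move=> r0_gt0 t0 t2 /andP[s'0 s's] EN Nt x0 Ex0.
(* The added 1 makes [C] positive even when [N = 0], so that it can be divided by. *)
pose C := 2 `^ s * (2 * N%:R * r0 `^ s') + 1.
have C0 : 0 < C by rewrite ltr_wpDl// !mulr_ge0 ?powR_ge0.
have Csup d : 0 < d <= r0 -> (packing_sup s E d <= (C * d `^ (s - s'))%:E)%E.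
  move=> /andP[d0 dr0]; apply: ge_ereal_sup => _ [F /packingP[FE Fd] <-].
  rewrite lee_fin.
  (* A finite packing has a smallest radius, which gives the number of scales to iterate. *)
  have [K FK] : exists K, forall b, b \in F -> t ^+ K * r0 < b.2.
    have [e e0 Fe] : exists2 e, 0 < e & forall b, b \in F -> e <= b.2.
      elim: F FE {Fd} => [|b F IH] FE; first by exists 1.
      have [|e e0 Fe] := IH; first by move=> c cF; apply: FE; rewrite inE cF orbT.
      have [_ /andP[b0 _]] := FE b (mem_head _ _).
      exists (Num.min e b.2); first by rewrite lt_min e0.
      move=> c; rewrite inE => /orP[/eqP->|/Fe]; first by rewrite ge_min lexx orbT.
      by move=> h; rewrite ge_min h.
    exists (Num.truncn (r0 / e)).+1 => b /Fe; apply: lt_le_trans.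
    set k := _.+1.
    have r0k : r0 < e * 2 ^+ k.
      rewrite mulrC -ltr_pdivrMr//; apply: lt_le_trans (truncnS_gt _) _.
      by rewrite -natrX ler_nat ltnW// ltn_expl.
    have tk : t ^+ k <= (2^-1) ^+ k by rewrite lerXn2r ?nnegrE// ltW.
    apply: le_lt_trans (ler_wpM2r (ltW r0_gt0) tk) _.
    by rewrite exprVn mulrC ltr_pdivrMr ?exprn_gt0.
  apply: (@le_trans _ _ (\sum_(b <- F) (2 `^ s * d `^ (s - s')) * b.2 `^ s')).
    rewrite !big_seq; apply: ler_sum => b /FE[_ /andP[b0 bd]].
    rewrite powRM ?(ltW b0)// -mulrA ler_wpM2l ?powR_ge0//.
    rewrite -{1}(subrK s' s) [leLHS]powRD ?(gt_eqF b0) ?implybT//.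
        by rewrite ler_wpM2r ?powR_ge0// ge0_ler_powR ?nnegrE// ?subr_ge0 ltW.
  rewrite -mulr_sumr -mulrA mulrCA mulrC -subr_ge0 -mulrBl mulr_ge0 ?powR_ge0//.
  rewrite subr_ge0 /C ler_wpDr// ler_wpM2l ?powR_ge0//.
  apply: (packing_sum_few_far E r0 t N s' t0 _ s'0 EN Nt K x0) => //; first lra.
    by rewrite r0_gt0 lexx.
  move=> b bF; have [Eb /andP[_ bd]] := FE b bF.
  by split; [|exact: Ex0|rewrite FK//= (le_trans bd)].
apply/eqP; rewrite eq_le packing_pre_ge0 andbT; apply/lee_addgt0Pr => e e0.
rewrite add0e.
pose d := Num.min r0 ((e / C) `^ (s - s')^-1).
have eC : 0 < e / C by rewrite divr_gt0.
have d0 : 0 < d by rewrite lt_min r0_gt0 powR_gt0.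
apply: (@le_trans _ _ (packing_sup s E d)); first by apply: ereal_inf_lbound; exists d.
apply: le_trans (Csup d _) _; first by rewrite d0 ge_min lexx.
rewrite lee_fin mulrC -ler_pdivlMr//.
apply: (@le_trans _ _ (((e / C) `^ (s - s')^-1) `^ (s - s'))).
  rewrite ge0_ler_powR ?nnegrE ?powR_ge0 ?(ltW d0)// ?subr_ge0 ?(ltW s's)//.
  by rewrite ge_min lexx orbT.
by rewrite -powRrM mulVf ?powRr1 ?(ltW eC)// subr_eq0 gt_eqF.
Qed.

Lemma floor_eq_near (a b : R) : Num.floor a = Num.floor b -> `|a - b| <= 1.
Proof.
move=> ab; have := floor_itv a; have := floor_itv b; rewrite ab intrD.
move=> /andP[? ?] /andP[? ?]; rewrite ler_norml; apply/andP; split; lra.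
Qed.

(** A countable grid of side [r0 / n.+1] cuts [E] into pieces of diameter at most [r0], each inside
    a ball of radius [r0] about any of its points. The premeasure of each piece vanishes. *)
Lemma packing_measure_few_far E r0 t N s' s : 0 < r0 -> 0 < t -> t <= 2^-1 ->
  0 <= s' < s -> few_far E r0 t N -> N%:R * t `^ s' <= 2^-1 ->
  packing_measure s E = 0%E.
Proof.
move=> r0_gt0 t0 t2 s's EN Nt; pose e := r0 / n.+1%:R.
have e0 : 0 < e by rewrite divr_gt0.
pose cell x : {ffun 'I_n -> int} := [ffun i => Num.floor (x ord0 i / e)].
pose P k := [set x | E x /\ unpickle k = Some (cell x)].
suff EP : E `<=` \bigcup_k P k.
  apply/eqP; rewrite eq_le packing_measure_ge0 andbT.
  apply: le_trans (le_packing_measure _ _ _ EP) _.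
  rewrite packing_measure_bigcup0// => k.
  apply/eqP; rewrite eq_le packing_measure_ge0 andbT.
  apply: le_trans (packing_measure_le_pre _ _) _.
  have [->|/set0P[x0 [Ex0 kx0]]] := eqVneq (P k) set0; first by rewrite packing_pre0.
  have PN : few_far (P k) r0 t N.
    by move=> x1 r Y rr0 YP; apply: (EN x1) => // y /YP[[Ey _] yr].
  rewrite (packing_pre_few_far _ _ _ _ _ _ r0_gt0 t0 t2 s's PN Nt x0)//.
  move=> x [_]; rewrite kx0 => -[/ffunP xx0].
  apply: (@le_trans _ _ (n%:R * e)).
    apply: enorm_le_entries => [|i]; first exact: ltW.
    have := xx0 i; rewrite !ffunE => /floor_eq_near.
    rewrite -mulrBl normrM (@gtr0_norm _ e^-1) ?invr_gt0// !mxE distrC.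
    by rewrite ler_pdivrMr// mul1r.
  by rewrite /e mulrCA ler_piMr ?(ltW r0_gt0)// ler_pdivrMr// mul1r ler_nat.
by move=> x Ex; exists (pickle (cell x)) => //; split=> //; rewrite pickleK.
Qed.

End Counting.

(** * Almost opposite points in a strip *)

Section Geometry.

(* Give each vertex its own colour together with the colours of the edges
   leading to later vertices of the same colour: along an edge of a colour
   that cannot be repeated, this label changes. *)
Lemma monochromatic_path (V W : finType) (N : nat) (vc : 'I_N -> V)
    (ec : 'I_N -> 'I_N -> W) : (#|V| * 2 ^ #|W| < N)%N ->
  exists i j k : 'I_N, [/\ (i < j < k)%N, vc i = vc j, vc k = vc j & ec i j = ec j k].
Proof.
move=> VWN; pose later (j : 'I_N) := ec j @: [pred k : 'I_N | (j < k)%N && (vc k == vc j)].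
pose f (j : 'I_N) := (vc j, later j).
have [i [j [ij fij]]] : exists i j : 'I_N, (i < j)%N /\ f i = f j.
  have /injectivePn[i [j ij fij]] : ~~ injectiveb f.
    apply/injectiveP => /(@leq_card _ _ f); rewrite card_ord card_prod -(cardsT {set W}) -powersetT card_powerset cardsT.
    by rewrite leqNgt VWN.
  have [h|h|/val_inj h] := ltngtP i j; last by rewrite h eqxx in ij.
    by exists i, j.
  by exists j, i.
have [vij lij] := fij.
(* The edge from [i] to [j] has a colour leaving [i], hence one leaving [j]; this yields [k]. *)
have : ec i j \in later i by apply: imset_f; rewrite inE ij vij eqxx.
rewrite lij => /imsetP[k]; rewrite inE => /andP[jk /eqP kj] eij.
by exists i, j, k; rewrite ij jk.
Qed.

Context {R : realType}.
Implicit Types (M e y : R).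

(** The interval [-M, M] is cut into steps of length [e], numbered by an ordinal so that cells can
    serve as colours; [cell_pt] is the left end of a cell. *)
Definition mesh M e : nat := Num.truncn (2 * M / e).
Definition cell M e y : 'I_(mesh M e).+1 := inord (Num.truncn ((y + M) / e)).
Definition cell_pt M e (k : 'I_(mesh M e).+1) : R := k%:R * e - M.

Lemma cell_ptP M e y : 0 < e -> `|y| <= M -> `|y - cell_pt M e (cell M e y)| <= e.
Proof.
move=> e0; rewrite ler_norml => /andP[My yM].
have yM0 : 0 <= (y + M) / e by rewrite divr_ge0 ?(ltW e0)//; lra.
rewrite /cell_pt inordK; last first.
  by rewrite ltnS le_truncn// ler_wpM2r ?invr_ge0 ?(ltW e0)//; lra.
have /andP[] := truncn_itv yM0; rewrite ler_pdivlMr// ltr_pdivrMr// -natr1.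
move=> h1 h2; rewrite ler_norml; apply/andP; split; lra.
Qed.

Lemma mesh_le M e : 0 < e -> e <= M -> (mesh M e).+1%:R <= 3 * M / e.
Proof.
move=> e0 eM; rewrite -natr1 (_ : 3 * M / e = 2 * M / e + M / e); last by ring.
apply: lerD; last by rewrite ler_pdivlMr// mul1r.
by rewrite truncn_le divr_ge0 ?(ltW e0)//; lra.
Qed.

Context {n : nat}.
Implicit Types (x z u : 'rV[R]_n).

Definition vcell M e u : {ffun 'I_n -> 'I_(mesh M e).+1} :=
  [ffun i => cell M e (u ord0 i)].
Definition vcell_pt M e (k : {ffun 'I_n -> 'I_(mesh M e).+1}) : 'rV[R]_n :=
  \row_i cell_pt M e (k i).

Lemma vcell_ptP M e u : 0 < e -> enorm u <= M ->
  enorm (u - vcell_pt M e (vcell M e u)) <= n%:R * e.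
Proof.
move=> e0 uM; apply: enorm_le_entries => [|i]; first exact: ltW.
by rewrite !mxE ffunE cell_ptP// (le_trans (entry_le_enorm _ _)).
Qed.

Definition unitv u := (enorm u)^-1 *: u.

Lemma enorm_unitv u : enorm (unitv u) <= 1.
Proof.
rewrite enormZ ger0_norm ?invr_ge0 ?enorm_ge0//.
have [->|u0] := eqVneq (enorm u) 0; first by rewrite mulr0.
by rewrite mulVf.
Qed.

Lemma edot_unitv u z : 0 < enorm u -> edot u z = enorm u * edot (unitv u) z.
Proof. by move=> u0; rewrite edotZl mulrA mulfV ?mul1r// gt_eqF. Qed.

(** The unit vectors of [x - u] and [z - x] lie in one cell, so they differ by at most [2 * a]. If
    the second has component above [a] along [theta], the first has component above [- a], and
    reversing it bounds that of [u - x]. *)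
Lemma opposite_directions (a : R) x u z : 0 < a ->
  0 < enorm (x - u) -> 0 < enorm (z - x) ->
  vcell 1 (a / n.+1%:R) (unitv (x - u)) = vcell 1 (a / n.+1%:R) (unitv (z - x)) ->
  forall theta, enorm theta = 1 ->
    edot (u - x) theta <= a * enorm (u - x) \/ edot (z - x) theta <= a * enorm (z - x).
Proof.
move=> a0 xu zx; set e := a / _ => exz theta theta1.
have e0 : 0 < e by rewrite divr_gt0.
have ne : n%:R * e <= a.
  by rewrite /e mulrCA ler_piMr ?(ltW a0)// ler_pdivrMr// mul1r ler_nat.
have h1 := vcell_ptP 1 e _ e0 (enorm_unitv (x - u)).
have h2 := vcell_ptP 1 e _ e0 (enorm_unitv (z - x)).
rewrite exz in h1; set p := vcell_pt _ _ _ in h1 h2.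
have h : enorm (unitv (z - x) - unitv (x - u)) <= 2 * a.
  by apply: le_trans (enorm_tri p _ _) _; rewrite (enormB p); lra.
have hth : edot (unitv (z - x)) theta - edot (unitv (x - u)) theta <= 2 * a.
  rewrite -edotNl -edotDl; apply: le_trans (ler_norm _) _.
  by apply: le_trans (edot_le _ _) _; rewrite theta1 mulr1.
rewrite -(opprB x u) edotNl enormN (edot_unitv (x - u))// (edot_unitv (z - x))//.
rewrite (mulrC a) -mulrN (mulrC a) !ler_pM2l//.
have [|] := leP (edot (unitv (z - x)) theta) a; [by right|left; lra].
Qed.

(** Replacing [us] by [nu] costs [2 * b] times the distance, and the strip width is at most as much
    because the points are more than [t * r] apart. The [m] terms then add up to at most m * 4b <=
    a; [m.+1] keeps [b] meaningful for [m = 0]. *)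
Lemma strip_cone (m : nat) (a : R) (x y : 'rV[R]_n) (nu : 'I_m -> 'rV[R]_n)
    (t r : R) (us : 'I_m -> 'rV[R]_n) (b := a / (4 * m.+1%:R)) : 0 < a -> 0 < t -> 0 < r ->
  t * r < enorm (x - y) ->
  (forall i, enorm (nu i - us i) <= 2 * b) ->
  (forall i, `|edot (y - x) (us i)| <= 2 * b * (t * r)) ->
  \sum_(i < m) `|edot (y - x) (nu i)| <= a * enorm (y - x).
Proof.
move=> a0 t0 r0; rewrite enormB => tr nus yx.
have b0 : 0 < b by rewrite divr_gt0// mulr_gt0.
have bE : m.+1%:R * (4 * b) = a by rewrite /b; field; rewrite nat1r pnatr_eq0.
clearbody b.
apply: (@le_trans _ _ (\sum_(i < m) 4 * b * enorm (y - x))).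
  apply: ler_sum => i _.
  rewrite -{1}(subrK (us i) (nu i)) edotDr; apply: le_trans (ler_normD _ _) _.
  have h1 : `|edot (y - x) (nu i - us i)| <= enorm (y - x) * (2 * b).
    by apply: le_trans (edot_le _ _) _; rewrite ler_wpM2l ?enorm_ge0.
  have h2 : 2 * b * (t * r) <= 2 * b * enorm (y - x).
    by rewrite ler_wpM2l ?(ltW tr)//; lra.
  have := yx i; lra.
rewrite sumr_const card_ord -[leLHS]mulr_natl mulrA ler_wpM2r ?enorm_ge0// -[leRHS]bE.
by rewrite ler_wpM2r ?ler_nat//; lra.
Qed.

(** Number of colours for [monochromatic_path], up to the factor t^(-m): rounded normals, then
    positions along them, then sets of rounded directions. *)
Definition cone_const (m : nat) (a : R) : R :=
  (((mesh 1 (a / (2 * m.+1%:R) / n.+1%:R)).+1 ^ n) ^ m)%:R *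
  (6 / (a / (4 * m.+1%:R))) ^+ m *
  (2 ^ ((mesh 1 (a / n.+1%:R)).+1 ^ n))%:R.

(** Vertices are coloured by strips and edges by rounded directions; a monochromatic path of two
    edges is the required triple. *)
Lemma cone_triple (m : nat) (a t r : R) x0 (X : seq 'rV[R]_n)
    (nu : 'rV[R]_n -> 'I_m -> 'rV[R]_n) :
  0 < a <= 1 -> 0 < t <= 1 -> 0 < r ->
  (forall x, x \in X -> enorm (x - x0) <= r /\ forall i, enorm (nu x i) = 1) ->
  pairwise (far (t * r)) X -> cone_const m a * (t^-1) ^+ m < (size X)%:R ->
  exists x y z : 'rV[R]_n, [/\ x \in X, y \in X & z \in X] /\
   [/\ t * r < enorm (y - x), t * r < enorm (z - x),
       \sum_(i < m) `|edot (y - x) (nu x i)| <= a * enorm (y - x),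
       \sum_(i < m) `|edot (z - x) (nu x i)| <= a * enorm (z - x) &
       forall theta, enorm theta = 1 -> edot (y - x) theta <= a * enorm (y - x) \/
         edot (z - x) theta <= a * enorm (z - x)].
Proof.
move=> /andP[a0 a1] /andP[t0 t1] r0 XP Xfar.
pose b := a / (4 * m.+1%:R).
have m1 : (1 : R) <= m.+1%:R by rewrite ler1n.
have b0 : 0 < b by rewrite divr_gt0// mulr_gt0.
have b1 : b <= 4^-1.
  rewrite ler_pdivrMr ?mulr_gt0// mulrA mulVf// mul1r.
  exact: le_trans a1 m1.
pose e1 := a / (2 * m.+1%:R) / n.+1%:R; pose e3 := a / n.+1%:R.
have e10 : 0 < e1 by rewrite !divr_gt0// mulr_gt0.
have ne1 : n%:R * e1 <= 2 * b.
  rewrite /e1 mulrCA (_ : 2 * b = a / (2 * m.+1%:R)); last first.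
    by rewrite /b; field; rewrite nat1r pnatr_eq0.
  by rewrite ler_piMr ?divr_ge0 ?(ltW a0)// ler_pdivrMr// mul1r ler_nat.
pose us x (i : 'I_m) := vcell_pt 1 e1 (vcell 1 e1 (nu x i)).
pose pos x (i : 'I_m) := edot (x - x0) (us x i) / r.
(* A colour records the rounded normals and the position along each of them in units of [r], to
   precision [b * t]. *)
pose V := ({ffun 'I_m -> {ffun 'I_n -> 'I_(mesh 1 e1).+1}} *
           {ffun 'I_m -> 'I_(mesh 2 (b * t)).+1})%type.
pose vcol x : V := ([ffun i => vcell 1 e1 (nu x i)],
                    [ffun i => cell 2 (b * t) (pos x i)]).
pose x_ (i : 'I_(size X)) := nth 0 X i.
have xX i : x_ i \in X by exact: mem_nth.
have bt0 : 0 < b * t by exact: mulr_gt0.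
have bt1 : b * t <= 1 by nra.
rewrite /cone_const -/e1 -/e3 -/b => card_lt.
have usP x : x \in X -> forall i, enorm (nu x i - us x i) <= 2 * b.
  by move=> /XP[_ nu1] i; apply: le_trans ne1; apply: vcell_ptP => //; rewrite nu1.
(* The rounded normals have length at most 1 + 2b <= 2. *)
have posP x : x \in X -> forall i, `|pos x i| <= 2.
  move=> xin i; have [xr nu1] := XP _ xin.
  rewrite /pos normrM (@gtr0_norm _ r^-1) ?invr_gt0// ler_pdivrMr//.
  apply: le_trans (edot_le _ _) _; rewrite mulrC.
  apply: ler_pM; rewrite ?enorm_ge0//.
  have := usP _ xin i; have := enorm_tri (nu x i) (us x i) 0.
  rewrite !subr0 nu1 (enormB (us x i)); lra.
have same_strip (x y : 'rV[R]_n) : x \in X -> y \in X -> vcol x = vcol y -> t * r < enorm (x - y) ->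
    \sum_(i < m) `|edot (y - x) (nu x i)| <= a * enorm (y - x).
  move=> xin yin [/ffunP us_eq /ffunP pos_eq] xy.
  apply: (strip_cone m a x y (nu x) t r (us x)) => // [|i]; first exact: usP.
  have uxy : us x i = us y i by have := us_eq i; rewrite !ffunE /us => ->.
  have := cell_ptP _ _ _ bt0 (posP _ xin i); have := cell_ptP _ _ _ bt0 (posP _ yin i).
  have := pos_eq i; rewrite !ffunE => ->; set c := cell_pt _ _ _ => yc xc.
  have -> : y - x = (y - x0) - (x - x0) by rewrite opprB addrA subrK.
  rewrite edotDl edotNl {1}uxy.
  have -> : edot (y - x0) (us y i) = r * pos y i by rewrite /pos mulrC divfK ?gt_eqF.
  have -> : edot (x - x0) (us x i) = r * pos x i by rewrite /pos mulrC divfK ?gt_eqF.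
  rewrite -mulrBr normrM (gtr0_norm r0) (_ : _ * (t * r) = r * (2 * (b * t))); last by rewrite -/b; ring.
  rewrite ler_pM2l//; apply: le_trans (ler_distD c _ _) _.
  by rewrite (distrC c); lra.
have far_x (i j : 'I_(size X)) : (i < j)%N -> t * r < enorm (x_ i - x_ j).
  by move/(pairwiseP 0): Xfar => h; apply: h; rewrite inE /= ltn_ord.
have [|i [j [k [/andP[ij jk] vij vkj eij]]]] := monochromatic_path V
    {ffun 'I_n -> 'I_(mesh 1 e3).+1} (size X) (vcol \o x_)
    (fun i j => vcell 1 e3 (unitv (x_ j - x_ i))).
  (* Each of the [m] positions takes at most 6 / (b t) values, whence t^(-m). *)
  rewrite card_prod !card_ffun !card_ord -(ltr_nat R); apply: le_lt_trans card_lt.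
  rewrite !natrM [leRHS]mulrAC ler_wpM2r// -[leRHS]mulrA ler_wpM2l//.
  rewrite natrX -exprMn lerXn2r ?nnegrE// ?mulr_ge0//.
  - by rewrite invr_ge0 ltW.
  - by rewrite invr_ge0 ltW.
  have := mesh_le 2 (b * t) bt0; rewrite invfM; nra.
have xij := far_x _ _ ij; have xjk := far_x _ _ jk.
have tr0 : 0 < t * r by exact: mulr_gt0.
(* The middle vertex is the apex: both edges have nearly the same direction, so the angle there is
   almost pi. *)
exists (x_ j), (x_ i), (x_ k); split=> //; split=> //.
- by rewrite enormB.
- by apply: same_strip => //; rewrite enormB.
- by apply: same_strip.
- apply: opposite_directions => //; rewrite enormB; exact: lt_trans tr0 _.
Qed.

End Geometry.

(** * Conical densities *)

Section ConicalDensity.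
Context {R : realType} {n : nat}.
Implicit Types (A : set 'rV[R]_n) (x y z theta : 'rV[R]_n) (V : 'M[R]_n).

(** With D the distance from [x] to [y], a point [z] of the ball has |z - x| >= 3D/4, while its
    distance to [V] and its component along [theta], both relative to [x], are at most 2aD <= alpha
    D/2. *)
Lemma cball_in_cone x y r V theta (a alpha : R) : 0 < a -> a <= 4^-1 * alpha ->
  alpha <= 1 -> 0 < enorm (y - x) ->
  dist_sub (y - x) V <= a * enorm (y - x) ->
  edot (y - x) theta <= a * enorm (y - x) -> enorm theta = 1 ->
  2 * enorm (y - x) <= r ->
  cball y (a * enorm (y - x)) `<=` Xcone_r x r V alpha `\` Hcone x theta alpha.
Proof.
move=> a0 a4 al1; set D := enorm (y - x) => D0 yV yth th1 Dr z /= zy.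
rewrite /cball /= in zy.
have zx : enorm (z - x) <= enorm (z - y) + D := enorm_tri y z x.
have yzx : D <= enorm (z - y) + enorm (z - x).
  by rewrite (enormB z y); exact: enorm_tri z y x.
have zyx : z - x = (z - y) + (y - x) by rewrite addrA subrK.
have al0 : 0 < alpha by lra.
have aD : a * D <= 4^-1 * alpha * D by rewrite ler_wpM2r ?(ltW D0).
have alD : alpha * D <= 1 * D by rewrite ler_wpM2r ?(ltW D0).
have alD0 : 0 < alpha * D by exact: mulr_gt0.
have alz : alpha * (3 / 4 * D) <= alpha * enorm (z - x) by rewrite ler_wpM2l ?(ltW al0)//; lra.
split.
  split; first by rewrite /cball /=; lra.
  rewrite /Xcone /=; apply: le_lt_trans (dist_sub_lip V _ (y - x)) _.
  by rewrite {1}zyx addrK; lra.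
rewrite /Hcone /=; apply/negP; rewrite -leNgt.
have : edot (z - y) theta <= enorm (z - y).
  by apply: le_trans (ler_norm _) _; apply: le_trans (edot_le _ _) _; rewrite th1 mulr1.
by move=> ?; rewrite {1}zyx edotDl; lra.
Qed.

(** The exceptional points for which a common [r0] works: fixing it lets the mass bound at one point
    be used against the cone bound at another. *)
Definition slim A (m : nat) (s alpha c1 c r0 : R) : set 'rV[R]_n :=
  [set x | A x /\ forall r, 0 < r < r0 ->
    ((c1 * (2 * r) `^ s)%:E < packing_measure s (A `&` cball x r))%E /\
    exists theta V, [/\ enorm theta = 1, grass (n - m) V &
      (packing_measure s ((A `&` Xcone_r x r V alpha) `\` Hcone x theta alpha) <
        (c * (2 * r) `^ s)%:E)%E]].

(** A longer separated list would contain the triple of [cone_triple]. For the [theta] and [V] given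
    at [x] and scale [4 * r], one of [y], [z] has its ball of radius [a * t * r] inside the cone
    set; being centred at a slim point, that ball is too massive. *)
Lemma slim_few_far A (m : nat) (s alpha c1 r0 t : R) (a := alpha / 4) :
  (m <= n)%N -> 0 <= s -> 0 < alpha <= 1 -> 0 < t <= 1 -> 0 <= c1 ->
  few_far (slim A m s alpha c1 (c1 * (a * t / 4) `^ s) r0) (r0 / 5) t
    (Num.truncn (cone_const (n := n) m a * (t^-1) ^+ m)).
Proof.
move=> mn s0 /andP[al0 al1] t01 c10 x0 r Y /andP[r_gt0 rr0] YE Yfar.
have [t0 t1] := andP t01.
have a0 : 0 < a by rewrite divr_gt0.
have a1 : 0 < a <= 1 by rewrite a0 /a; lra.
rewrite leqNgt; apply/negP; rewrite -ltnS => YN.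
(* Points of [Y] are at most [2 * r] apart and [cball_in_cone] asks for twice that; dividing [r0] by
   5 keeps the inequality strict. *)
have r4 : 0 < 4 * r < r0 by lra.
have /choice[f fP] : forall x, exists f : 'rV[R]_n * 'M[R]_n * ('I_m -> 'rV[R]_n),
    x \in Y -> [/\ enorm f.1.1 = 1,
      (packing_measure s ((A `&` Xcone_r x (4 * r) f.1.2 alpha) `\` Hcone x f.1.1 alpha) <
        (c1 * (a * t / 4) `^ s * (2 * (4 * r)) `^ s)%:E)%E,
      forall i, enorm (f.2 i) = 1 &
      forall w, dist_sub w f.1.2 <= \sum_(i < m) `|edot w (f.2 i)|].
  move=> x; have [/YE[[_ /(_ _ r4)[_ [th [V [th1 VG P]]]]] _]|] := pselect (is_true (x \in Y)).
    have [|nu [nu1 nuV]] := dist_sub_normals m V.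
      by rewrite VG subnK.
    by exists (th, V, nu).
  by exists (0, 0, fun=> 0).
have [||x [y [z [[xY yY zY] [yx zx nuy nuz yzth]]]]] :=
    cone_triple m a t r x0 Y (fun x => (f x).2) a1 t01 r_gt0 _ Yfar.
- by move=> x xY; have [_ ?] := YE _ xY; have [_ _ nu1 _] := fP _ xY.
- by apply: lt_le_trans (truncnS_gt _) _; rewrite ler_nat.
have [th1 P _ dV] := fP _ xY.
have contra y' : y' \in Y -> t * r < enorm (y' - x) ->
    \sum_(i < m) `|edot (y' - x) ((f x).2 i)| <= a * enorm (y' - x) ->
    ~ edot (y' - x) (f x).1.1 <= a * enorm (y' - x).
  move=> yY' yx' nuy' yth'.
  have [[_ Sy] yr] := YE _ yY'; have [_ xr] := YE _ xY.
  have atr : 0 < a * t * r < r0.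
    have [_ a_le1] := andP a1.
    have at1 : a * t <= 1 by rewrite mulr_ile1 ?(ltW a0) ?(ltW t0).
    have : a * t * r <= 1 * r by rewrite ler_wpM2r ?(ltW r_gt0).
    rewrite !mulr_gt0//= mul1r => /le_lt_trans; apply; clear -r_gt0 rr0; lra.
  have [thick _] := Sy _ atr.
  suff /le_lt_trans/(_ P)/(lt_trans thick) : (packing_measure s (A `&` cball y' (a * t * r)) <=
      packing_measure s ((A `&` Xcone_r x (4 * r) (f x).1.2 alpha) `\` Hcone x (f x).1.1 alpha))%E.
    (* The constant is chosen so that the cone bound at scale [4 * r] equals the mass bound c1 (2 a
       t r)^s at scale [a * t * r]. *)
    rewrite lte_fin -[ltRHS]mulrA -powRM; [|by rewrite divr_ge0 ?mulr_ge0 ?ltW|lra].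
    by rewrite (_ : a * t / 4 * (2 * (4 * r)) = 2 * (a * t * r)) ?ltxx//; field.
  have tr0 : 0 < t * r by exact: mulr_gt0.
  have yx0 := lt_trans tr0 yx'.
  apply: le_packing_measure => w [Aw yw].
  have [|||Xw Hw] := cball_in_cone x y' (4 * r) (f x).1.2 (f x).1.1 a alpha a0 _ al1 yx0
      (le_trans (dV _) nuy') yth' th1 _ w _.
  - by rewrite /a mulrC.
  - have : enorm (y' - x) <= 2 * r.
      by apply: le_trans (enorm_tri x0 _ _) _; rewrite (enormB x0) mulr2n mulrDl mul1r lerD.
    by clear; lra.
  - by apply: le_trans yw _; rewrite -mulrA ler_wpM2l ?(ltW a0)// ltW.
  - by split=> //; split.
by case: (yzth _ th1); apply: contra.
Qed.

End ConicalDensity.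

(** The exponent [s'] is the midpoint of [m] and [s]: the count is at most C t^(-m) with [C] the
    value of [cone_const], and C t^(s' - m) <= 1/2 for the chosen [t]. *)
Lemma slim_null {R : realType} {n : nat} (A : set 'rV[R]_n) (m : nat)
    (s alpha c1 r0 t : R) (a := alpha / 4) (s' := (s + m%:R) / 2) :
  (m <= n)%N -> m%:R < s -> 0 < alpha <= 1 -> 0 < t <= 2^-1 -> 0 <= c1 -> 0 < r0 ->
  cone_const (n := n) m a * t `^ (s' - m%:R) <= 2^-1 ->
  packing_measure s (slim A m s alpha c1 (c1 * (a * t / 4) `^ s) r0) = 0%E.
Proof.
move=> mn ms al01 /andP[t0 t2] c10 r0_gt0 Ct.
have m0 : (0 : R) <= m%:R by [].
have s0 : 0 <= s by lra.
have t1 : 0 < t <= 1 by lra.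
apply: (@packing_measure_few_far _ _ _ (r0 / 5) t _ s') (slim_few_far A m s alpha c1 r0 t mn s0 al01 t1 c10) _ => //.
- by rewrite divr_gt0.
- by rewrite /s'; lra.
apply: le_trans Ct.
rewrite powRB ?(gt_eqF t0) ?implybT// powR_mulrn ?(ltW t0)//.
rewrite mulrCA [leRHS]mulrC ler_wpM2r ?powR_ge0// -/a -exprVn truncn_le.
rewrite mulr_ge0 ?exprn_ge0 ?invr_ge0 ?(ltW t0)//.
have [al0 _] := andP al01.
by rewrite /cone_const !mulr_ge0// exprn_ge0// !divr_ge0 ?(ltW al0).
Qed.

Lemma small_scale {R : realType} (C e : R) : 0 < C -> 0 < e ->
  exists2 t, 0 < t <= 2^-1 & C * t `^ e <= 2^-1.
Proof.
move=> C0 e0; pose u := (2 * C)^-1 `^ e^-1.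
have u0 : 0 < u by rewrite powR_gt0// invr_gt0 mulr_gt0.
exists (Num.min 2^-1 u); first by rewrite lt_min u0 ge_min lexx invr_gt0 ltr0n.
apply: (@le_trans _ _ (C * u `^ e)).
  rewrite ler_wpM2l ?(ltW C0)// ge0_ler_powR ?nnegrE ?(ltW e0) ?(ltW u0)//.
    by rewrite le_min (ltW u0) invr_ge0 ler0n.
  by rewrite ge_min lexx orbT.
rewrite -powRrM mulVf ?gt_eqF// powRr1 ?invr_ge0 ?mulr_ge0 ?(ltW C0)//.
by rewrite invfM mulrCA divff ?mulr1// gt_eqF.
Qed.

Lemma limsup0_lt {R : realType} (f : R -> \bar R) (c : \bar R) :
  (limsup0 f < c)%E -> exists2 d, 0 < d & forall r, 0 < r < d -> (f r < c)%E.
Proof.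
move=> /ereal_inf_lt[_ [d d0 <-] h]; exists d => // r rd.
by apply: le_lt_trans h; apply: ereal_sup_ubound; exists r.
Qed.

Theorem theorem3p1 (R : realType) (n m : nat) (s alpha : R) :
  (m < n)%N -> m%:R < s -> s <= n%:R -> 0 < alpha -> alpha <= 1 ->
  exists c : R, 0 < c /\
    forall A : set 'rV[R]_n,
      (packing_measure s A < +oo)%E ->
      packing_measure s
        [set x | A x /\
           ~ (c%:E <= limsup0 (fun r : R =>
               ereal_inf [set (packing_measure s
                                 ((A `&` Xcone_r x r tV.2 alpha) `\` Hcone x tV.1 alpha)
                               * ((2 * r) `^ s)^-1%:E)%E
                         | tV in [set tV : 'rV[R]_n * 'M[R]_n |
                                   sphere tV.1 /\ grass (n - m) tV.2]]))%E] = 0%E.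
Proof.
move=> mn ms sn al0 al1; pose a := alpha / 4.
have m0 : (0 : R) <= m%:R by [].
have s0 : 0 <= s by lra.
have a0 : 0 < a by rewrite divr_gt0.
pose C := cone_const (R := R) (n := n) m a.
have C0 : 0 < C.
  by rewrite !mulr_gt0// ?exprn_gt0// ?divr_gt0// ?ltr0n ?expn_gt0.
(* [t] is fixed before [A], so [c] depends only on [n], [m], [s] and [alpha]. *)
have [t /andP[t0 t2] Ct] : exists2 t, 0 < t <= 2^-1 &
    C * t `^ ((s + m%:R) / 2 - m%:R) <= 2^-1.
  by apply: small_scale => //; lra.
pose c1 := 2^-1 * 3 `^ (- s) : R.
have c10 : 0 < c1 by rewrite mulr_gt0 ?powR_gt0.
pose c := c1 * (a * t / 4) `^ s.
exists c; split; first by rewrite mulr_gt0// powR_gt0// !mulr_gt0.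
move=> A Afin; set bad := [set x | _].
(* At a bad point the cone bound holds at all small scales; outside [thin] so does the lower mass
   bound. Countably many values of [r0] account for all such points. *)
have badE : bad `<=` thin A s `|` \bigcup_k slim A m s alpha c1 c (k.+1%:R^-1).
  move=> x [Ax /negP]; rewrite -ltNge => /limsup0_lt[d1 d10 Hd1].
  have [|thinN] := pselect (thin A s x); [by left|right].
  have [d2 d20 Hd2] : exists2 d, 0 < d & forall r, 0 < r < d ->
      ((c1 * (2 * r) `^ s)%:E < packing_measure s (A `&` cball x r))%E.
    apply: contrapT => H; apply: thinN; split=> // d d0.
    apply: contrapT => Hr; apply: H; exists d => // r rd.
    by rewrite ltNge; apply/negP => h; apply: Hr; exists r.
  pose d := Num.min d1 d2; have d0 : 0 < d by rewrite lt_min d10.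
  (* With this index, 1/(k + 1) < d. *)
  exists (Num.truncn d^-1) => //; split=> // r /andP[r0 rk].
  have : r < d.
    apply: lt_trans rk _; rewrite -ltf_pV2 ?posrE// invrK.
    exact: truncnS_gt.
  rewrite lt_min => /andP[rd1 rd2]; split; first by apply: Hd2; rewrite r0.
  have /ereal_inf_lt[_ [[th V] [/= th1 VG] <-]] := Hd1 r (introT andP (conj r0 rd1)).
  have w0 : 0 < (2 * r) `^ s by rewrite powR_gt0// mulr_gt0.
  by rewrite lte_pdivrMr// -EFinM => h; exists th, V.
apply/eqP; rewrite eq_le packing_measure_ge0 andbT.
apply: le_trans (le_packing_measure _ _ _ badE) _.
apply: le_trans (packing_measureU _ _ _) _.
rewrite packing_measure_thin// add0e packing_measure_bigcup0// => k.
by apply: slim_null => //; rewrite ?al0 ?t0 ?invr_gt0 ?(ltnW mn) ?(ltW c10).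
Qed.
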